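(* Let $x$ be an allocation rule and suppose Assumptions D, X and T hold. Consider the Optimal Transfer Problem (P): maximize $\sum_{i=1}^2\int_\Theta T_i(\theta)\,dP(\theta)$ over transfer rules $t$ such that (i) $(x,t)$ is feasible and (ii) $t\in\mathcal{T}$. Consider also the Reduced Problem (R): maximize $\sum_{i=1}^2\int_\Theta T_i(\theta)\,dP(\theta)$ over transfer rules $t$ such that (i) $t$ is win-lose dependent (for $x$), (ii) $U_i^{\min}(\theta)=\int_{\underline\theta}^{\theta}X_i^{\min}(z)\,dz$ for every $i$ and every $\theta\in\Theta$, and (iii) $t\in\mathcal{T}$. Then every solution (maximizer) of problem (R) is a solution of problem (P).
   Context: Let $\Theta=[\underline\theta,\bar\theta]\subset\mathbb{R}$ with $0<\underline\theta<\bar\theta$, with Borel $\sigma$-algebra $\mathcal{B}$; ''$\sigma$-algebra'' always means a sub-$\sigma$-algebra of $\mathcal{B}$, and $\Delta(\Theta,\mathcal{A})$ is the set of probability measures on $(\Theta,\mathcal{A})$. For $\mathcal{E}\subset\mathcal{A}$ and $P\in\Delta(\Theta,\mathcal{A})$, $P_{\mathcal{E}}$ denotes the restriction of $P$ to $\mathcal{E}$. A divergence $D$ assigns to each pair $Q,P$ of probability measures on a common $\sigma$-algebra a number $D(Q\|P)\in[0,\infty]$. Assumption D: for every $\sigma$-algebra $\mathcal{A}$ and $P,Q\in\Delta(\Theta,\mathcal{A})$: (D1) $D(Q\|P)=0$ if $Q=P$; (D2) if $Q\ll P$ and $dQ/dP$ is bounded, then $\epsilon\mapsto D(\epsilon Q+(1-\epsilon)P\|P)$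 is continuous on $[0,1]$; (D3) if $D(Q\|P)<\infty$ then $Q\ll P$; (D4) for every sub-$\sigma$-algebra $\mathcal{E}\subset\mathcal{A}$, $D(Q_{\mathcal{E}}\|P_{\mathcal{E}})\le D(Q\|P)$; (D5) for every sub-$\sigma$-algebra $\mathcal{E}\subset\mathcal{A}$, $D(Q_{\mathcal{E}}\|P_{\mathcal{E}})=D(Q\|P)$ if $dQ_{\mathcal{E}}/dP_{\mathcal{E}}=dQ/dP$ $P$-a.e. Fix an atomless $P\in\Delta(\Theta,\mathcal{B})$ (the reference belief) and $\eta>0$; ''a.e.'' means with respect to $P$ (or $P\otimes P$). There are two bidders $i\in\{1,2\}$. An allocation rule is a bounded measurable $x=(x_1,x_2):\Theta^2\to\mathbb{R}^2$ with $x_1(\theta,\theta')\ge0$, $x_2(\theta',\theta)\ge0$, $x_1(\theta,\theta')+x_2(\theta',\theta)\le1$ for all $\theta,\theta'$; a transfer rule is a bounded measurable $t=(t_1,t_2):\Theta^2\to\mathbb{R}^2$ ($x_i(\theta,\theta')$, $t_i(\theta,\theta')$ are bidder $i$'s winning probability and payment when she reports $\theta$ and the other reports $\theta'$). Define $X_i(\theta)=\int x_i(\theta,\theta')dP(\theta')$, $X_i^{\min}(\theta)=\inf_Q\{\int x_i(\theta,\theta')dQ(\theta'):D(Q\|P)\le\eta\}$, $U_i^{\min}(\theta)=\inf_Q\{\int[\theta x_i(\theta,\theta')-t_i(\theta,\theta')]dQ(\theta'):D(Q\|P)\le\eta\}$, $T_i(\theta)=\int t_i(\theta,\theta')dP(\theta')$,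 where $Q$ ranges over $\Delta(\Theta,\mathcal{B})$. $(x,t)$ is incentive compatible if for all $i,\theta$, $\theta$ maximizes over $\hat\theta\in\Theta$ the quantity $\inf_Q\{\int[\theta x_i(\hat\theta,\theta')-t_i(\hat\theta,\theta')]dQ(\theta'):D(Q\|P)\le\eta\}$; individually rational if $U_i^{\min}(\theta)\ge0$ for all $i,\theta$; feasible if both hold. Assumption X (on $x$): (i) $x_i(\theta,\theta')\in\{0,1\}$ whenever $\theta'\neq\theta$; (ii) $X_i(\theta)=1$ implies $\theta=\bar\theta$; (iii) $X_i^{\min}$ is non-decreasing. Assumption T: constants $0\le\alpha\le\beta\le1$, $K\ge0$ are given, and $\mathcal{T}$ is the class of transfer rules $t$ such that for every $i$, every $\theta<\bar\theta$ and all $\theta^w,\theta^l$ with $x_i(\theta,\theta^w)=1$ and $x_i(\theta,\theta^l)=0$, one has $\alpha t_i(\theta,\theta^w)-\beta t_i(\theta,\theta^l)\le K$. A transfer rule $t$ is win-lose dependent (for $x$) if there exist $t_i^w,t_i^l:\Theta\to\mathbb{R}$ with $t_i(\theta,\theta')=t_i^w(\theta)x_i(\theta,\theta')+t_i^l(\theta)[1-x_i(\theta,\theta')]$ and $\theta-t_i^w(\theta)\ge-t_i^l(\theta)$ for all $i,\theta,\theta'$. *)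

(* Defs.v *)
From HB Require Import structures.
From mathcomp Require Import all_boot all_order all_algebra.
From mathcomp Require Import all_classical all_reals all_analysis.
Set Implicit Arguments. Unset Strict Implicit. Unset Printing Implicit Defensive.
Import Order.TTheory GRing.Theory Num.Theory.
Import numFieldNormedType.Exports.
Local Open Scope classical_set_scope.
Local Open Scope ring_scope.

Section Model.
Context {R : realType}.
Variables (a b : R).

Definition Theta : set R := `[a, b].

Definition BorelTheta : set (set R) := [set S | S `<=` Theta /\ measurable S].

Definition sub_sigma (A : set (set R)) : Prop :=
  [/\ sigma_algebra Theta A, (forall S, A S -> S `<=` Theta)
    & (forall S, A S -> BorelTheta S)].

(** Measurable space (Theta, A); the carrier is R, probability measures on
   (Theta, A) are the probability measures on it giving mass 1 to Theta. *)
End Model.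
Definition gsT {R : realType} (A : set (set R)) : measurableType (sigma_display A) :=
  g_sigma_algebraType (A : set (set (R : pointedType))).
Section Model2.
Context {R : realType}.
Variables (a b : R).
Local Notation Theta := (Theta a b).
Local Notation BorelTheta := (BorelTheta a b).
Local Notation sub_sigma := (sub_sigma a b).

Definition isProbTheta (A : set (set R)) (P : probability (gsT A) R) : Prop :=
  P (Theta : set (gsT A)) = 1%E.

(** A divergence: for a sigma-algebra A and two (set functions representing)
   probability measures on (Theta, A), a value in \bar R. *)
Definition divergence := set (set R) -> (set R -> \bar R) -> (set R -> \bar R) -> \bar R.

(** Restriction of a set function to the sets of A (0 elsewhere): this is how
   a measure on (Theta, A) (or its restriction to a sub-sigma-algebra) is
   handed to a divergence, so that D(Q||P) only depends on Q, P on A. *)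
Definition restrict (A : set (set R)) (m : set R -> \bar R) : set R -> \bar R :=
  fun S => if `[< A S >] then m S else 0%E.

Definition Dv (D : divergence) (A : set (set R)) (Q P : set R -> \bar R) : \bar R :=
  D A (restrict A Q) (restrict A P).

Definition is_density (E A : set (set R)) (P : probability (gsT A) R)
  (Q : set R -> \bar R) (f : R -> R) : Prop :=
  measurable_fun (Theta : set (gsT E)) (f : gsT E -> R) /\
  forall S, E S -> Q S = (\int[P]_(x in (S : set (gsT A))) (f x)%:E)%E.

Definition assumptionD (D : divergence) : Prop :=
  forall A, sub_sigma A ->
  forall P Q : probability (gsT A) R, isProbTheta P -> isProbTheta Q ->
      (0 <= Dv D A Q P)%E /\
  [/\
      ((forall S, A S -> Q S = P S) -> Dv D A Q P = 0%E),
      ((exists f M, is_density A P Q f /\ (forall x, Theta x -> `|f x| <= M)) ->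
        {within `[0, 1], continuous
          (fun e : R => Dv D A (fun S => (e%:E * Q S + (1 - e)%:E * P S)%E) P)}),
      ((Dv D A Q P < +oo)%E -> forall S, A S -> P S = 0%E -> Q S = 0%E),
      (forall E, sub_sigma E -> E `<=` A -> (Dv D E Q P <= Dv D A Q P)%E) &
      (forall E, sub_sigma E -> E `<=` A ->
        (exists f g, [/\ is_density E P Q f, is_density A P Q g &
           {ae P, forall x, Theta x -> f x = g x}]) ->
        Dv D E Q P = Dv D A Q P)].

Definition atomless (P : probability (gsT BorelTheta) R) : Prop :=
  forall S : set (gsT BorelTheta), measurable S -> (0 < P S)%E ->
  exists S' : set (gsT BorelTheta), [/\ measurable S', S' `<=` S &
    (0 < P S' < P S)%E].

Section Auction.
Variables (D : divergence) (P : probability (gsT BorelTheta) R) (eta : R).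

Definition worst_case (g : R -> R) : \bar R :=
  ereal_inf [set v | exists Q : probability (gsT BorelTheta) R,
    [/\ isProbTheta Q, (Dv D BorelTheta Q P <= eta%:E)%E &
        v = (\int[Q]_(y in (Theta : set (gsT BorelTheta))) (g y)%:E)%E]].

Definition bidder1 : 'I_2 := ord0.
Definition bidder2 : 'I_2 := ord_max.

Definition bounded_measurable (f : R -> R -> R) : Prop :=
  measurable_fun (Theta `*` Theta : set (R * R)) (fun p : R * R => f p.1 p.2) /\
  exists M : R, forall th th', Theta th -> Theta th' -> `|f th th'| <= M.

(** x i th th' : winning probability of bidder i reporting th, other th'. *)
Definition allocation_rule (x : 'I_2 -> R -> R -> R) : Prop :=
  (forall i, bounded_measurable (x i)) /\
  forall th th', Theta th -> Theta th' ->
    [/\ 0 <= x bidder1 th th', 0 <= x bidder2 th' th &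
        x bidder1 th th' + x bidder2 th' th <= 1].

Definition transfer_rule (t : 'I_2 -> R -> R -> R) : Prop :=
  forall i, bounded_measurable (t i).

Definition Xexp (x : 'I_2 -> R -> R -> R) i th : \bar R :=
  (\int[P]_(y in (Theta : set (gsT BorelTheta))) (x i th y)%:E)%E.

Definition Xmin (x : 'I_2 -> R -> R -> R) i th : \bar R := worst_case (x i th).

Definition Urep (x t : 'I_2 -> R -> R -> R) i th thhat : \bar R :=
  worst_case (fun y => th * x i thhat y - t i thhat y).

Definition Umin (x t : 'I_2 -> R -> R -> R) i th : \bar R := Urep x t i th th.

Definition Texp (t : 'I_2 -> R -> R -> R) i th : \bar R :=
  (\int[P]_(y in (Theta : set (gsT BorelTheta))) (t i th y)%:E)%E.

Definition incentive_compatible (x t : 'I_2 -> R -> R -> R) : Prop :=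
  forall i th thhat, Theta th -> Theta thhat -> (Urep x t i th thhat <= Urep x t i th th)%E.

Definition individually_rational (x t : 'I_2 -> R -> R -> R) : Prop :=
  forall i th, Theta th -> (0 <= Umin x t i th)%E.

Definition feasible (x t : 'I_2 -> R -> R -> R) : Prop :=
  incentive_compatible x t /\ individually_rational x t.

Definition assumptionX (x : 'I_2 -> R -> R -> R) : Prop :=
  [/\ (forall i th th', Theta th -> Theta th' -> th' != th ->
         x i th th' = 0 \/ x i th th' = 1),
      (forall i th, Theta th -> Xexp x i th = 1%E -> th = b) &
      (forall i th th', Theta th -> Theta th' -> th <= th' ->
         (Xmin x i th <= Xmin x i th')%E)].

Definition in_Tclass (alpha beta K : R) (x t : 'I_2 -> R -> R -> R) : Prop :=
  forall i th thw thl, Theta th -> th < b -> Theta thw -> Theta thl ->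
    x i th thw = 1 -> x i th thl = 0 ->
    alpha * t i th thw - beta * t i th thl <= K.

Definition win_lose_dependent (x t : 'I_2 -> R -> R -> R) : Prop :=
  exists tw tl : 'I_2 -> R -> R, forall i th, Theta th ->
    (forall th', Theta th' ->
       t i th th' = tw i th * x i th th' + tl i th * (1 - x i th th')) /\
    - tl i th <= th - tw i th.

Definition revenue (t : 'I_2 -> R -> R -> R) : \bar R :=
  (\sum_(i < 2) \int[P]_(th in (Theta : set (gsT BorelTheta))) Texp t i th)%E.

Definition admissibleP alpha beta K x t : Prop :=
  [/\ transfer_rule t, feasible x t & in_Tclass alpha beta K x t].

Definition admissibleR alpha beta K x t : Prop :=
  [/\ transfer_rule t, win_lose_dependent x t,
      (forall i th, Theta th ->
         Umin x t i th = (\int[lebesgue_measure]_(z in `[a, th]) Xmin x i z)%E)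
    & in_Tclass alpha beta K x t].

Definition solvesP alpha beta K x t : Prop :=
  admissibleP alpha beta K x t /\
  forall t', admissibleP alpha beta K x t' -> (revenue t' <= revenue t)%E.

Definition solvesR alpha beta K x t : Prop :=
  admissibleR alpha beta K x t /\
  forall t', admissibleR alpha beta K x t' -> (revenue t' <= revenue t)%E.

End Auction.
End Model2.

(* Main.v *)
(* Replacing the payments of a feasible mechanism by their conditional means
   given winning and given losing insures the bidder: for any plausible belief
   Q, the belief Q' that gives the two events their Q-probabilities and agrees
   with P conditionally on each of them has D(Q'||P) <= D(Q||P), and under Q'
   the old payments are worth what the averaged ones are under Q. If winning is
   then still worse than losing, full insurance is even cheaper. Incentive
   compatibility forces U(th) >= V(th), where V is the integral of X^min, so a
   constant can be added to both payments to bring the utility down to V(th).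
   The result is admissible for the reduced problem and earns at least as much,
   type by type. Conversely, a win-lose dependent rule with utility V is
   incentive compatible because V has slope X^min and X^min is monotone. *)

Require Import Defs.
From HB Require Import structures.
From mathcomp Require Import all_boot all_order all_algebra.
From mathcomp Require Import all_classical all_reals all_analysis.
From mathcomp Require Import measurable_realfun ring lra.
Set Implicit Arguments. Unset Strict Implicit. Unset Printing Implicit Defensive.
Import Order.TTheory GRing.Theory Num.Theory.
Import numFieldNormedType.Exports.
Local Open Scope classical_set_scope.
Local Open Scope ring_scope.

(** * Bounded measurable functions on [Theta] and their expectations *)

Section BorelTheta.
Context {R : realType} (a b : R).
Local Notation Th := (Theta a b).
Local Notation T := (gsT (BorelTheta a b)).
Implicit Types (Q : probability T R) (f g : R -> R).

(** Measurability refers to the Borel structure of [R], where the closure lemmas for real functions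
    apply; [measurable_fun_Theta] transfers it to the structure carrying the beliefs. *)
Definition bm g : Prop :=
  measurable_fun Th g /\ exists M : R, forall y, Th y -> `|g y| <= M.

Definition Ex Q g : R := fine (\int[Q]_(y in (Th : set T)) (g y)%:E)%E.

Lemma measurable_ThetaR : measurable Th.
Proof. exact: measurable_itv. Qed.

Lemma measurable_BorelTheta (S : set R) :
  S `<=` Th -> measurable S -> measurable (S : set T).
Proof. by move=> ST mS; apply: sub_sigma_algebra. Qed.

Lemma measurable_Theta : measurable (Th : set T).
Proof. exact: measurable_BorelTheta measurable_ThetaR. Qed.

Lemma measurable_fun_Theta d (U : measurableType d) (g : R -> U) :
  measurable_fun Th g -> measurable_fun (Th : set T) (g : T -> U).
Proof.
move=> mg _ Y mY; apply: measurable_BorelTheta; first exact: subIsetl.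
exact: mg measurable_ThetaR _ mY.
Qed.

Lemma bm_integrable Q g (A : set R) : bm g -> A `<=` Th -> measurable A ->
  Q.-integrable (A : set T) (EFin \o g).
Proof.
move=> [mg [M gM]] ATh mA; apply: measurable_bounded_integrable.
- exact: measurable_BorelTheta.
- by rewrite (le_lt_trans (probability_le1 _ _)) ?ltry//;
    exact: measurable_BorelTheta.
- apply: measurable_funS (measurable_fun_Theta mg) => //.
  exact: measurable_Theta.
- exists M; split; first exact: num_real.
  by move=> N MN y Ay; exact: le_trans (gM _ (ATh _ Ay)) (ltW MN).
Qed.

Lemma bm_Theta_integrable Q g : bm g -> Q.-integrable (Th : set T) (EFin \o g).
Proof. by move=> ?; apply: bm_integrable => //; exact: measurable_ThetaR. Qed.

Lemma integralEx Q g : bm g ->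
  (\int[Q]_(y in (Th : set T)) (g y)%:E)%E = (Ex Q g)%:E.
Proof.
move=> bg; rewrite fineK//; apply: integrable_fin_num.
- exact: measurable_Theta.
- exact: bm_Theta_integrable.
Qed.

Lemma bm_cst c : bm (fun=> c).
Proof. by split; [exact: measurable_cst | exists `|c|]. Qed.

Lemma bmD f g : bm f -> bm g -> bm (fun y => f y + g y).
Proof.
move=> [mf [M fM]] [mg [N gN]]; split; first exact: measurable_funD.
exists (M + N) => y Ty; rewrite (le_trans (ler_normD _ _))// lerD//.
  exact: fM.
exact: gN.
Qed.

Lemma bmM f g : bm f -> bm g -> bm (fun y => f y * g y).
Proof.
move=> [mf [M fM]] [mg [N gN]]; split; first exact: measurable_funM.
by exists (M * N) => y Ty; rewrite normrM ler_pM ?fM ?gN.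
Qed.

Lemma bmZ c g : bm g -> bm (fun y => c * g y).
Proof. exact: bmM (bm_cst c). Qed.

Lemma bmN g : bm g -> bm (fun y => - g y).
Proof.
move=> [mg [M gM]]; split; first exact: measurableT_comp.
by exists M => y Ty; rewrite normrN gM.
Qed.

Lemma bmB f g : bm f -> bm g -> bm (fun y => f y - g y).
Proof. by move=> bf bg; exact: bmD bf (bmN bg). Qed.

Lemma bm_max f g : bm f -> bm g -> bm (fun y => Num.max (f y) (g y)).
Proof.
move=> [mf [M fM]] [mg [N gN]]; split; first exact: measurable_maxr.
exists (Num.max M N) => y Ty; rewrite le_max.
by have [_|_] := leP (f y) (g y); rewrite ?fM ?gN ?orbT.
Qed.

Lemma eq_Ex Q f g : {in Th, f =1 g} -> Ex Q f = Ex Q g.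
Proof. by move=> fg; congr fine; apply: eq_integral => y /fg ->. Qed.

Lemma ExD Q f g : bm f -> bm g -> Ex Q (fun y => f y + g y) = Ex Q f + Ex Q g.
Proof.
by move=> bf bg; apply: RintegralD;
  [exact: measurable_Theta|exact: bm_Theta_integrable..].
Qed.

Lemma ExB Q f g : bm f -> bm g -> Ex Q (fun y => f y - g y) = Ex Q f - Ex Q g.
Proof.
by move=> bf bg; apply: RintegralB;
  [exact: measurable_Theta|exact: bm_Theta_integrable..].
Qed.

Lemma ExZ Q c g : bm g -> Ex Q (fun y => c * g y) = c * Ex Q g.
Proof.
by move=> bg; apply: RintegralZl;
  [exact: measurable_Theta|exact: bm_Theta_integrable].
Qed.

Lemma Ex_cst Q c : isProbTheta a b Q -> Ex Q (fun=> c) = c.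
Proof.
move=> QT; rewrite /Ex integral_cst; last exact: measurable_Theta.
by rewrite /= QT mule1.
Qed.

Lemma le_Ex Q f g : bm f -> bm g -> (forall y, Th y -> f y <= g y) ->
  Ex Q f <= Ex Q g.
Proof.
move=> bf bg fg; apply: (@le_Rintegral _ T R Q Th f g _ _ _ fg).
- exact: measurable_Theta.
- exact: bm_Theta_integrable.
- exact: bm_Theta_integrable.
Qed.

Lemma Ex_affine Q c d g : isProbTheta a b Q -> bm g ->
  Ex Q (fun y => c * g y + d) = c * Ex Q g + d.
Proof.
by move=> QT bg; rewrite ExD ?ExZ ?Ex_cst//; [exact: bmZ | exact: bm_cst].
Qed.

Lemma Ex_ge0 Q g : (forall y, Th y -> 0 <= g y) -> 0 <= Ex Q g.
Proof. by move=> g0; exact: (@Rintegral_ge0 _ T R Q Th g g0). Qed.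

Lemma normr_Ex Q g M : isProbTheta a b Q -> bm g ->
  (forall y, Th y -> `|g y| <= M) -> `|Ex Q g| <= M.
Proof.
move=> QT bg gM; rewrite ler_norml -{1}(Ex_cst (- M) QT) -{2}(Ex_cst M QT).
apply/andP; split; apply: le_Ex => //; try exact: bm_cst.
- by move=> y /gM; rewrite ler_norml => /andP[].
- by move=> y /gM; rewrite ler_norml => /andP[].
Qed.

Lemma bounded_measurable_section (h : R -> R -> R) th :
  bounded_measurable a b h -> Th th -> bm (h th).
Proof.
move=> [mh [M hM]] Tth; split; last by exists M => y Ty; exact: hM.
apply: (@measurable_comp _ _ _ _ _ _ (Th `*` Th) (fun p : R * R => h p.1 p.2)
  Th (fun y => (th, y))).
- exact: measurableX measurable_ThetaR measurable_ThetaR.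
- by move=> _ [y Ty <-].
- exact: mh.
- by apply: measurable_funTS; exact: measurable_pair1.
Qed.

Lemma bounded_measurableM (h k : R -> R -> R) :
  bounded_measurable a b h -> bounded_measurable a b k ->
  bounded_measurable a b (fun th y => h th y * k th y).
Proof.
move=> [mh [M hM]] [mk [N kN]]; split; first exact: measurable_funM.
by exists (M * N) => th y Tth Ty; rewrite normrM ler_pM ?hM ?kN.
Qed.

Lemma bounded_measurableD (h k : R -> R -> R) :
  bounded_measurable a b h -> bounded_measurable a b k ->
  bounded_measurable a b (fun th y => h th y + k th y).
Proof.
move=> [mh [M hM]] [mk [N kN]]; split; first exact: measurable_funD.
exists (M + N) => th y Tth Ty; rewrite (le_trans (ler_normD _ _))// lerD//.
  exact: hM.
exact: kN.
Qed.

Lemma bounded_measurableN (h : R -> R -> R) :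
  bounded_measurable a b h -> bounded_measurable a b (fun th y => - h th y).
Proof.
move=> [mh [M hM]]; split; first exact: measurableT_comp.
by exists M => th y Tth Ty; rewrite normrN hM.
Qed.

Lemma bounded_measurable1 g : bm g -> bounded_measurable a b (fun th _ => g th).
Proof.
move=> [mg [M gM]]; split; last by exists M => th y Tth _; exact: gM.
apply: (@measurable_comp _ _ _ _ _ _ Th g (Th `*` Th) (fun p : R * R => p.1)).
- exact: measurable_ThetaR.
- by move=> _ [p [Tp _] <-].
- exact: mg.
- by apply: measurable_funTS; exact: measurable_fst.
Qed.

(* Points outside Theta are sent to [b + 1], where the extension by zero of the
   integrand vanishes, so that the integral over the whole space only sees
   Theta. *)
Lemma bm_Ex Q (h : R -> R -> R) : isProbTheta a b Q ->
  bounded_measurable a b h -> bm (fun th => Ex Q (h th)).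
Proof.
move=> QT bh; have [mh [M hM]] := bh.
split; last first.
  exists M => th Tth; apply: normr_Ex => //.
    exact: bounded_measurable_section.
  by move=> y; exact: hM.
(* Adding the bound [M] makes the integrand nonnegative, so that Tonelli gives measurability of the
   partial integral; [M] is subtracted again at the end. *)
pose F := ((fun p : R * R => (h p.1 p.2 + M)%:E) \_ (Th `*` Th))%E.
pose r (y : T) : R := if y \in Th then (y : R) else b + 1.
have mF : measurable_fun setT F.
  apply/(measurable_restrictT _ _).1.
    exact: measurableX measurable_ThetaR measurable_ThetaR.
  apply/measurable_EFinP; apply: measurable_funD => //.
have mr : measurable_fun setT r.
  apply: measurable_fun_if => //.
  - apply: (measurable_fun_bool true).
    rewrite setTI (_ : _ @^-1` _ = Th); first exact: measurable_Theta.
    by apply/seteqP; split=> y; [exact: set_mem|exact: mem_set].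
  - rewrite setTI (_ : _ @^-1` _ = Th); last first.
      by apply/seteqP; split=> y; [exact: set_mem|exact: mem_set].
    exact: (@measurable_fun_Theta _ _ id).
have mG : measurable_fun setT (fun p : R * T => F (p.1, r p.2)).
  have mp : measurable_fun setT (fun p : R * T => (p.1, r p.2)).
    by apply: measurable_fun_pair; [exact: measurable_fst|
      exact: measurableT_comp mr measurable_snd].
  exact: (measurableT_comp mF mp).
have F0 p : (0 <= F p)%E.
  rewrite /F /patch; case: ifPn => //; rewrite inE => -[T1 T2].
  rewrite lee_fin -lerBlDr sub0r.
  by have := hM _ _ T1 T2; rewrite ler_norml => /andP[].
have mI := measurable_fun_fubini_tonelli_F (m2 := Q) _ mG (fun p => F0 _).
apply: (eq_measurable_fun (fun th => fine (fubini_F Q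
  (fun p : R * T => F (p.1, r p.2)) th) - M)).
  move=> th; rewrite inE => Tth.
  have bhth : bm (h th) by exact: bounded_measurable_section.
  apply/eqP; rewrite subr_eq -{1}(Ex_cst M QT) -ExD//; last exact: bm_cst.
  apply/eqP; rewrite /Ex [in RHS]integral_mkcond; congr fine.
  apply: eq_integral => y _; rewrite /F /r /patch /=.
  have [/[!inE] Ty|/negP nTy] := boolP (y \in Th).
    by rewrite mem_set.
  case: ifPn => //; rewrite inE => -[_ /=].
  by rewrite /Theta /= in_itv/= gerDl ler10 andbF.
apply: measurable_funB => //; apply: measurable_funTS.
apply: measurableT_comp; last exact: mI.
exact: fine_measurable.
Qed.

End BorelTheta.

(** * Worst-case expectations over the plausible beliefs *)

Section WorstCase.
Context {R : realType} (a b : R).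
Local Notation Th := (Theta a b).
Local Notation T := (gsT (BorelTheta a b)).
Variables (D : @divergence R) (P : probability T R) (eta : R).
Hypotheses (hD : assumptionD a b D) (hP : isProbTheta a b P) (heta : 0 < eta).
Implicit Types (Q : probability T R) (g : R -> R).

Definition plausible Q : Prop :=
  isProbTheta a b Q /\ (Dv D (BorelTheta a b) Q P <= eta%:E)%E.

Definition wc g : R := fine (worst_case D P eta g).

Lemma sub_sigma_BorelTheta : sub_sigma a b (BorelTheta a b).
Proof.
split=> [|S []//|//]; split; first by split => //; exact: sub0set.
- move=> S [ST mS]; split; first by move=> y [].
  by apply: measurableD => //; exact: measurable_ThetaR.
- move=> F FB; split; first by move=> y [n _ Fy]; exact: (FB n).1 Fy.
  by apply: bigcup_measurable => n _; exact: (FB n).2.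
Qed.

Lemma plausible_ref : plausible P.
Proof.
split=> //; have [_ [D1 _ _ _ _]] := hD sub_sigma_BorelTheta hP hP.
by rewrite D1// lee_fin ltW.
Qed.

Lemma worst_case_lb c g : bm a b g ->
  (forall Q, plausible Q -> c <= Ex Q g) ->
  (c%:E <= worst_case D P eta g)%E.
Proof.
move=> bg cg; apply: le_ereal_inf_tmp => _ [Q [QT QD ->]].
by rewrite integralEx// lee_fin; apply: cg.
Qed.

Lemma worst_case_ub Q g : bm a b g -> plausible Q ->
  (worst_case D P eta g <= (Ex Q g)%:E)%E.
Proof.
move=> bg [QT QD]; apply: ereal_inf_lbound; exists Q; split => //.
by rewrite integralEx.
Qed.

(** The bound of [g] keeps the infimum above [-oo], and the plausible belief [P] keeps it below
    [+oo]. *)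
Lemma worst_caseE g : bm a b g -> worst_case D P eta g = (wc g)%:E.
Proof.
move=> bg; rewrite fineK// fin_numE; have [_ [M gM]] := bg.
apply/andP; split.
- rewrite -ltNye (lt_le_trans (ltNyr (- M)))//.
  apply: worst_case_lb => // Q [QT _].
  by have := normr_Ex QT bg gM; rewrite ler_norml => /andP[].
- by rewrite -ltey (le_lt_trans (worst_case_ub bg plausible_ref))// ltry.
Qed.

Lemma wc_lb c g : bm a b g -> (forall Q, plausible Q -> c <= Ex Q g) ->
  c <= wc g.
Proof. by move=> bg cg; rewrite -lee_fin -worst_caseE//; apply: worst_case_lb. Qed.

Lemma wc_ub Q g : bm a b g -> plausible Q -> wc g <= Ex Q g.
Proof. by move=> bg QQ; rewrite -lee_fin -worst_caseE//; apply: worst_case_ub. Qed.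

Lemma eq_wc f g : {in Th, f =1 g} -> wc f = wc g.
Proof.
move=> fg; congr fine; congr ereal_inf; apply/seteqP.
by split=> _ [Q [QT QD ->]]; exists Q; split => //; apply: eq_integral => y;
  move=> /fg ->.
Qed.

(** The sign of [c] is left free because a misreporting type may prefer losing. For [c <= 0] the
    belief [P] is a sufficient test, as [wc g <= Ex P g]; for [c > 0] the infimum commutes with the
    affine map. *)
Lemma wc_affine_le c d g : bm a b g -> wc (fun y => c * g y + d) <= c * wc g + d.
Proof.
move=> bg; have bcg : bm a b (fun y => c * g y + d).
  by apply: bmD; [exact: bmZ|exact: bm_cst].
have [c0|c0] := leP c 0.
  rewrite (le_trans (wc_ub bcg plausible_ref))// Ex_affine// lerD2r.
  by rewrite ler_wnM2l// wc_ub//; exact: plausible_ref.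
rewrite -lerBlDr mulrC -ler_pdivrMr//; apply: wc_lb => // Q QQ.
rewrite ler_pdivrMr// mulrC lerBlDr -Ex_affine//; first exact: wc_ub.
by case: QQ.
Qed.

Lemma wc_affine c d g : 0 <= c -> bm a b g ->
  wc (fun y => c * g y + d) = c * wc g + d.
Proof.
move=> c0 bg; apply/eqP; rewrite eq_le wc_affine_le//=.
apply: wc_lb => [|Q QQ]; first by apply: bmD; [exact: bmZ|exact: bm_cst].
rewrite Ex_affine ?lerD2r ?ler_wpM2l ?wc_ub//; by case: QQ.
Qed.

(** An infimum is superadditive: nature may use a different belief for each summand on the left. *)
Lemma wcD f g : bm a b f -> bm a b g -> wc f + wc g <= wc (fun y => f y + g y).
Proof.
move=> bf bg; apply: wc_lb => [|Q QQ]; first exact: bmD.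
by rewrite ExD// lerD// wc_ub.
Qed.

End WorstCase.

(** * Reweighting a probability on a set and on its complement *)

Section MeasurePieces.
Context d (T : measurableType d) (R : realType).

(** The nonnegative case applies to the positive and negative parts; integrability lets [k]
    distribute over their difference. *)
Lemma integral_mscale (m : {measure set T -> \bar R}) (k : {nonneg R})
    (A : set T) (f : T -> \bar R) : measurable A -> m.-integrable A f ->
  (\int[mscale k m]_(x in A) f x = k%:num%:E * \int[m]_(x in A) f x)%E.
Proof.
move=> mA intf; have mf := measurable_int m intf.
rewrite [LHS]integralE (integralE m A f) ge0_integral_mscale//; last first.
  exact: measurable_funepos.
rewrite ge0_integral_mscale//; last exact: measurable_funeneg.
by rewrite [RHS]muleBr//; apply: fin_num_adde_defr; exact: integrable_pos_fin_num.
Qed.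

Section Reweight.
Variables (P : probability T R) (W : set T) (mW : measurable W).
Variables (p q : {nonneg R}).

(** The measure with density [p] on [W] and [q] off [W] with respect to [P]. With the right [p] and
    [q] it is the Jeffrey update of [P], which gives [W] a new probability and keeps the conditional
    laws. *)
Definition reweight : set T -> \bar R :=
  measure_add (mscale p (mrestr P mW)) (mscale q (mrestr P (measurableC mW))).

HB.instance Definition _ := Measure.on reweight.

Lemma reweightE S :
  reweight S = (p%:num%:E * P (S `&` W) + q%:num%:E * P (S `&` ~` W))%E.
Proof. by rewrite /reweight measure_addE. Qed.

Lemma ex_reweight_probability :
  (p%:num%:E * P W + q%:num%:E * P (~` W) = 1)%E ->
  exists Q : probability T R, Q = reweight :> (set T -> \bar R).
Proof.
move=> pq1; have rT : reweight setT = 1%E by rewrite reweightE !setTI.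
pose rP := Measure_isProbability.Build _ _ _ reweight rT.
pose Q : probability T R := HB.pack reweight rP.
by exists Q.
Qed.

Lemma integral_reweight (A : set T) (f : T -> \bar R) :
  measurable A -> P.-integrable A f ->
  (\int[reweight]_(x in A) f x =
   p%:num%:E * \int[P]_(x in A `&` W) f x +
   q%:num%:E * \int[P]_(x in A `&` ~` W) f x)%E.
Proof.
move=> mA intf; have mAW : measurable (A `&` W) by exact: measurableI.
have mAC : measurable (A `&` ~` W).
  by apply: measurableI => //; exact: measurableC.
have mf := measurable_int P intf.
have AE : (A `&` W) `|` (A `&` ~` W) = A by rewrite -setIUr setUv setIT.
rewrite -{1}AE integral_setU//; last 2 first.
- by rewrite AE.
- by apply/disj_set2P; rewrite setIACA setICr setI0.
congr (_ + _)%E.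
- rewrite -integral_mscale//; last exact: integrableS intf.
  apply: eq_measure_integral => B mB BAW; rewrite /= reweightE.
  rewrite setIidl; last by move=> y /BAW[].
  rewrite (_ : B `&` ~` W = set0) ?measure0 ?mule0 ?adde0//.
  by apply/disjoints_subset; rewrite setCK => y /BAW[].
- rewrite -integral_mscale//; last exact: integrableS intf.
  apply: eq_measure_integral => B mB BAW; rewrite /= reweightE.
  rewrite [B `&` ~` _]setIidl; last by move=> y /BAW[].
  rewrite (_ : B `&` W = set0) ?measure0 ?mule0 ?add0e//.
  by apply/disjoints_subset => y /BAW[].
Qed.

End Reweight.
End MeasurePieces.

(** * Coarsening a plausible belief to the events of winning and losing *)

Section Coarsening.
Context {R : realType} (a b : R).
Local Notation Th := (Theta a b).
Local Notation T := (gsT (BorelTheta a b)).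
Variables (D : @divergence R) (P : probability T R) (eta : R).
Hypotheses (hD : assumptionD a b D) (hP : isProbTheta a b P).
Variables (W : set R) (WTh : W `<=` Th) (mW : measurable W).

(** The algebra generated in [Theta] by [W]. As traces of preimages of sets of booleans, its members
    are closed under complement and countable union because preimages commute with these
    operations. *)
Definition two_cell : set (set R) :=
  [set S | exists A : set bool, S = Th `&` (fun y => y \in W) @^-1` A].

Lemma two_cell_Borel : two_cell `<=` BorelTheta a b.
Proof.
move=> _ [A ->]; split; first exact: subIsetl.
have mf : measurable_fun setT (fun y : R => y \in W).
  apply: (measurable_fun_bool true).
  by rewrite setTI (_ : _ @^-1` _ = W)//; apply/seteqP;
    split=> y; [exact: set_mem|exact: mem_set].
apply: measurableI; first exact: measurable_ThetaR.
by rewrite -[X in measurable X]setTI; exact: mf.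
Qed.

Lemma sub_sigma_two_cell : sub_sigma a b two_cell.
Proof.
split; last exact: two_cell_Borel; last by move=> S /two_cell_Borel [].
split.
- by exists set0; rewrite preimage_set0 setI0.
- move=> _ [A ->]; exists (~` A).
  by rewrite preimage_setC setDIr setDv set0U.
- move=> F /choice[A FA]; exists (\bigcup_n A n).
  rewrite preimage_bigcup setI_bigcupr; apply: eq_bigcupr => n _; exact: FA.
Qed.

Lemma two_cellI (S : set R) : two_cell S ->
  (S `&` W = W \/ S `&` W = set0) /\
  (S `&` ~` W = Th `\` W \/ S `&` ~` W = set0).
Proof.
move=> [A ->]; split.
- have [At|At] := pselect (A true); [left|right]; apply/seteqP.
  + by split=> [y []//|y Wy]; split => //; split; [exact: WTh|rewrite /= mem_set].
  + by split=> // y [[_]]; rewrite /= => + Wy; rewrite mem_set.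
- have [Af|Af] := pselect (A false); [left|right]; apply/seteqP.
  + split=> [y [[]]//|y [Ty Wy]]; split => //; split => //=.
    by rewrite memNset.
  + by split=> // y [[_]]; rewrite /= => + Wy; rewrite memNset.
Qed.

Lemma bm_indic : bm a b \1_W.
Proof.
split; first by apply: measurable_funTS; exact: measurable_indic.
by exists 1 => y _; rewrite indicE normr_nat lern1 leq_b1.
Qed.

Lemma Ex_indic (Q : probability T R) : Ex Q \1_W = fine (Q (W : set T)).
Proof.
rewrite /Ex integral_indic ?setIidl//; first exact: measurable_Theta.
exact: measurable_BorelTheta.
Qed.

(* The two-cell algebra is sufficient for the pair (Q', P), whence
   D(Q'||P) = D(Q'_E||P_E) = D(Q_E||P_E) <= D(Q||P). *)
Lemma plausible_coarsening (Q : probability T R) :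
  plausible D P eta Q -> 0 < Ex P \1_W < 1 ->
  exists2 Q' : probability T R, plausible D P eta Q' &
    forall g, bm a b g ->
      Ex Q' g = Ex Q \1_W / Ex P \1_W * Ex P (fun y => g y * \1_W y) +
        (1 - Ex Q \1_W) / (1 - Ex P \1_W) * Ex P (fun y => g y * (1 - \1_W y)).
Proof.
move=> [QT QD] /andP[p0 p1].
set w := Ex P \1_W in p0 p1 *; set v := Ex Q \1_W.
have mWT : measurable (W : set T) by exact: measurable_BorelTheta.
have mTh := @measurable_Theta R a b.
have PW : P (W : set T) = w%:E by rewrite /w Ex_indic fineK// fin_num_measure.
have QW : Q (W : set T) = v%:E by rewrite /v Ex_indic fineK// fin_num_measure.
have v0 : 0 <= v by apply: Ex_ge0 => y _; rewrite indicE.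
have v1 : v <= 1.
  by rewrite -lee_fin -QW; exact: probability_le1.
have cW (Q0 : probability T R) u : isProbTheta a b Q0 ->
    Q0 (W : set T) = u%:E -> Q0 (Th `\` W : set T) = (1 - u)%:E.
  move=> Q0T Q0W; rewrite measureD//=; last 1 first.
  - by rewrite ltey_eq fin_num_measure.
  - by rewrite Q0T (setIidr WTh) Q0W.
have p_ge0 : 0 <= v / w by rewrite divr_ge0// ltW.
have q_ge0 : 0 <= (1 - v) / (1 - w) by rewrite divr_ge0 ?subr_ge0// ltW.
(* The ratios of the [Q]-probability to the [P]-probability of each cell: the reweighted [P] then
   agrees with [Q] on both cells. *)
pose p := NngNum p_ge0; pose q := NngNum q_ge0.
have w_neq0 : w != 0 by rewrite gt_eqF.
have w1_neq0 : 1 - w != 0 by rewrite subr_eq0 eq_sym lt_eqF.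
have pq1 : (p%:num%:E * P (W : set T) + q%:num%:E * P (~` W : set T) = 1)%E.
  rewrite probability_setC// PW /= -EFinB -!EFinM -EFinD !mulfVK//.
  by rewrite addrC subrK.
have [Q' Q'E] := ex_reweight_probability mWT pq1.
have Q'S S : Q' S = (p%:num%:E * P (S `&` W : set T)
    + q%:num%:E * P (S `&` ~` W : set T))%E by rewrite Q'E reweightE.
(* This density of [Q'] is constant on each cell, hence measurable already for [two_cell]; the same
   function is therefore a density on both algebras, as (D5) requires. *)
pose f (y : R) : R := if y \in W then v / w else (1 - v) / (1 - w).
have f_two_cell Y : two_cell (Th `&` f @^-1` Y).
  exists [set c | Y (if c then v / w else (1 - v) / (1 - w))].
  by [].
have mf : measurable_fun Th f.
  by move=> _ Y _; exact: (two_cell_Borel (f_two_cell Y)).2.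
have bf : bm a b f.
  split => //; exists (v / w + (1 - v) / (1 - w)) => y _.
  by rewrite /f; case: ifPn => _; rewrite ger0_norm// ?lerDl ?lerDr.
have densf S : BorelTheta a b S ->
    Q' S = (\int[P]_(y in (S : set T)) (f y)%:E)%E.
  move=> [STh mS]; have mST : measurable (S : set T) by exact: measurable_BorelTheta.
  have mSW : measurable (S `&` W : set T) by exact: measurableI.
  have mSC : measurable (S `&` ~` W : set T).
    by apply: measurableI => //; exact: measurableC.
  have SE : (S `&` W) `|` (S `&` ~` W) = S by rewrite -setIUr setUv setIT.
  rewrite Q'S -{3}SE integral_setU//; last 2 first.
  - rewrite SE; apply/measurable_EFinP.
    exact: measurable_funS (measurable_fun_Theta mf).
  - by apply/disj_set2P; rewrite setIACA setICr setI0.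
  congr (_ + _)%E; rewrite -integral_cst//; apply: eq_integral => y /set_mem[_ Wy].
    by rewrite /f mem_set.
  by rewrite /f memNset.
have QQ' S : two_cell S -> Q' S = Q S.
  move=> Sc; have [STh mS] := two_cell_Borel Sc.
  have mST : measurable (S : set T) by exact: measurable_BorelTheta.
  have -> : Q S = (Q (S `&` W : set T) + Q (S `&` ~` W : set T))%E.
    rewrite -measureU//; first by rewrite -setIUr setUv setIT.
    - exact: measurableI.
    - by apply: measurableI => //; exact: measurableC.
    - by rewrite setIACA setICr setI0.
  rewrite Q'S; have [SW SC] := two_cellI Sc; congr (_ + _)%E.
  - by case: SW => ->; rewrite ?measure0 ?mule0// PW QW -EFinM mulfVK.
  - case: SC => ->; rewrite ?measure0 ?mule0//.
    by rewrite (cW _ _ hP PW) (cW _ _ QT QW) -EFinM mulfVK.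
have Q'T : isProbTheta a b Q'.
  rewrite /isProbTheta QQ'//; exists setT.
  by rewrite preimage_setT setIT.
exists Q'.
- split => //.
  have [_ [_ _ _ D4 _]] := hD (sub_sigma_BorelTheta a b) hP QT.
  have [_ [_ _ _ _ D5]] := hD (sub_sigma_BorelTheta a b) hP Q'T.
  rewrite -(D5 _ sub_sigma_two_cell two_cell_Borel).
  + apply: le_trans QD.
    rewrite (_ : Dv D two_cell Q' P = Dv D two_cell Q P).
      exact: D4 sub_sigma_two_cell two_cell_Borel.
    (* Both restrictions are 0 off [two_cell], so agreement of [Q'] and [Q] on the cells makes the
       arguments of [D] equal as functions. *)
    rewrite /Dv; congr D; apply/funext => S; rewrite /Defs.restrict.
    by case: asboolP => // /QQ'.
  + exists f, f; split.
    * split; last by move=> S /two_cell_Borel /densf.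
      by move=> _ Y _; apply: sub_sigma_algebra; exact: f_two_cell.
    * by split=> //; exact: (measurable_fun_Theta mf).
    * exact: (@aeW _ T R P (fun y => Th y -> f y = f y) (fun _ _ => erefl)).
- move=> g bg; have ig := bm_Theta_integrable P bg.
  have bgW := bmM bg bm_indic.
  have bgC := bmM bg (bmB (bm_cst a b 1) bm_indic).
  apply: EFin_inj; rewrite -integralEx// Q'E integral_reweight//.
  rewrite EFinD (EFinM (v / w)) (EFinM ((1 - v) / (1 - w))).
  rewrite -(integralEx _ bgW) -(integralEx _ bgC).
  rewrite !integral_mkcondr; congr (_ * _ + _ * _)%E; apply: eq_integral => y _.
  + by rewrite /patch indicE; case: ifPn => _; rewrite ?mulr1 ?mulr0.
  + rewrite /patch indicE in_setC; case: ifPn => /= [/negbTE ->|/negPn ->].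
      by rewrite subr0 mulr1.
    by rewrite subrr mulr0.
Qed.

End Coarsening.

(** * The primitive of a monotone function with values in the unit interval *)

Section MonotonePrimitive.
Context {R : realType} (a b : R).
Local Notation Th := (Theta a b).

Lemma ThetaE y : Th y = (a <= y <= b).
Proof. by rewrite /Theta /= in_itv. Qed.

(** Composing [m] with the clamp onto [[a, b]] gives a function that is monotone on all of [R] and
    agrees with [m] on [Theta]. *)
Lemma nondecreasing_in_measurable (m : R -> R) :
  (forall s s', Th s -> Th s' -> s <= s' -> m s <= m s') -> measurable_fun Th m.
Proof.
move=> mnd; have [ab|ba] := leP a b; last first.
  rewrite (_ : Th = set0); first exact: measurable_fun_set0.
  apply/seteqP; split=> // y; rewrite ThetaE => /andP[ay yb].
  by have := le_trans ay yb; rewrite leNgt ba.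
pose cl z := Num.max a (Num.min z b).
have clT z : Th (cl z).
  by rewrite ThetaE /cl le_max lexx/= ge_max ab ge_min lexx orbT.
apply: (eq_measurable_fun (fun z => m (cl z))).
  move=> z; rewrite inE ThetaE => /andP[az zb].
  by rewrite /cl (min_idPl zb) (max_idPr az).
apply: nondecreasing_measurable; first exact: measurable_ThetaR.
move=> z z' zz'; apply: mnd => //; rewrite /cl.
by rewrite le_max2// le_min2.
Qed.

Variable m : R -> R.
Hypothesis m01 : forall s, Th s -> 0 <= m s <= 1.
Hypothesis mnd : forall s s', Th s -> Th s' -> s <= s' -> m s <= m s'.

Definition primitive (th : R) : R := \int[lebesgue_measure]_(z in `[a, th]) m z.

Lemma monotone_integrable (A : set R) : measurable A -> A `<=` Th ->
  lebesgue_measure.-integrable A (EFin \o m).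
Proof.
move=> mA ATh; have mTh := @measurable_ThetaR R a b.
apply: (@integrableS _ (measurableTypeR R) R lebesgue_measure Th A _ mTh mA ATh).
apply: (@measurable_bounded_integrable _ (measurableTypeR R)) => //.
- rewrite /Theta /= lebesgue_measure_itv/=; case: ifPn => _; last exact: ltry.
  by rewrite -EFinB ltry.
- exact: nondecreasing_in_measurable.
- exists 1; split; first exact: num_real.
  move=> N N1 y Ty; apply: le_trans (ltW N1).
  by have /andP[m0 m1] := m01 Ty; rewrite /= ger0_norm.
Qed.

Lemma integral_primitive th : Th th ->
  (\int[lebesgue_measure]_(z in `[a, th]) (m z)%:E = (primitive th)%:E)%E.
Proof.
move=> Tth; rewrite fineK//; apply: integrable_fin_num => //.
apply: monotone_integrable => //= y /=; rewrite in_itv/= ThetaE.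
move: Tth; rewrite ThetaE => /andP[_ thb] /andP[-> /le_trans]; exact.
Qed.

(** By monotonicity the integrand on []s, s']] lies between [m s] and [m s']. These bounds say that
    [m] is a subgradient of the primitive and take the place of differentiation. *)
Lemma primitive_increment s s' : Th s -> Th s' -> s <= s' ->
  (s' - s) * m s <= primitive s' - primitive s <= (s' - s) * m s'.
Proof.
move=> Ts Ts' ss'; have := Ts; have := Ts'; rewrite !ThetaE.
move=> /andP[as' s'b] /andP[as_ sb].
have sub : `]s, s'] `<=` Th.
  move=> y /=; rewrite in_itv/= ThetaE => /andP[sy ys'].
  by rewrite (le_trans as_ (ltW sy)) (le_trans ys' s'b).
have im : lebesgue_measure.-integrable `]s, s'] (EFin \o m).
  by apply: monotone_integrable => //; exact: measurable_itv.
rewrite /primitive Rintegral_itvB//; last first.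
  apply: monotone_integrable; first exact: measurable_itv.
  move=> y /=; rewrite in_itv/= ThetaE => /andP[-> ys'].
  exact: le_trans ys' s'b.
have cstE c : \int[lebesgue_measure]_(z in `]s, s']) c = (s' - s) * c.
  rewrite Rintegral_cst//= lebesgue_measure_itv/= lte_fin.
  move: ss'; rewrite le_eqVlt => /predU1P[->|ss'].
    by rewrite ltxx subrr mul0r mulr0.
  by rewrite ss' mulrC.
have ic c : lebesgue_measure.-integrable `]s, s'] (EFin \o (fun=> c : R)).
  apply: measurable_bounded_integrable => //.
  - rewrite /= lebesgue_measure_itv/=; case: ifPn => _; last exact: ltry.
    by rewrite -EFinB ltry.
  - by exists `|c|; split; [exact: num_real|move=> N N1 y _; exact: ltW].
rewrite -!cstE; apply/andP; split; apply: le_Rintegral => // y ys.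
- apply: mnd => //; first exact: sub.
  by move: ys; rewrite /= in_itv/= => /andP[/ltW].
- apply: mnd => //; first exact: sub.
  by move: ys; rewrite /= in_itv/= => /andP[].
Qed.

Lemma primitive_left : primitive a = 0.
Proof. by rewrite /primitive set_itv1 Rintegral_set1. Qed.

Lemma primitive_ge0 th : Th th -> 0 <= primitive th.
Proof.
move=> Tth; apply: Rintegral_ge0 => y /=; rewrite in_itv/= => /andP[ay yth].
have : Th y.
  by move: Tth; rewrite !ThetaE ay => /andP[_]; exact: le_trans.
by move/m01 => /andP[].
Qed.

Lemma primitive_nondecreasing s s' : Th s -> Th s' -> s <= s' ->
  primitive s <= primitive s'.
Proof.
move=> Ts Ts' ss'; rewrite -subr_ge0.
have /andP[+ _] := primitive_increment Ts Ts' ss'; apply: le_trans.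
by have /andP[m0 _] := m01 Ts; rewrite mulr_ge0// subr_ge0.
Qed.

(* Along a subdivision of step h, the quantity U - V + h m, where V is the
   primitive of m, does not decrease; hence U >= V - h for every h = (th - a) / n. *)
Lemma le_primitive (U : R -> R) : 0 <= U a ->
  (forall s s', Th s -> Th s' -> s <= s' -> U s + (s' - s) * m s <= U s') ->
  forall th, Th th -> primitive th <= U th.
Proof.
move=> Ua0 Uinc th Tth; have := Tth; rewrite ThetaE => /andP[ath thb].
have Ta : Th a by rewrite ThetaE lexx (le_trans ath).
apply/ler_addgt0Pr => e e0.
(* The error left at [th] is [h * m th <= h]; this [n] makes [h <= e]. *)
pose n := (Num.truncn ((th - a) / e)).+1.
pose h := (th - a) / n%:R.
have n0 : 0 < n%:R :> R by rewrite ltr0n.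
have h0 : 0 <= h by rewrite divr_ge0 ?subr_ge0// ltW.
have he : h <= e.
  rewrite ler_pdivrMr// mulrC -ler_pdivrMr//; apply: ltW.
  exact: truncnS_gt.
have hn : a + n%:R * h = th by rewrite /h mulrC divfK ?gt_eqF// addrC subrK.
have Tk k : (k <= n)%N -> Th (a + k%:R * h).
  move=> kn; rewrite ThetaE lerDl mulr_ge0//=.
  apply: le_trans thb; rewrite -hn lerD2l ler_wpM2r//.
  by rewrite ler_nat.
have step k : (k <= n)%N ->
    0 <= U (a + k%:R * h) - primitive (a + k%:R * h) + h * m (a + k%:R * h).
  elim: k => [_|k IH kn].
    rewrite mul0r addr0 primitive_left subr0 addr_ge0//.
    by have /andP[m0 _] := m01 Ta; rewrite mulr_ge0.
  have Tk0 := Tk k (ltnW kn); have Tk1 := Tk k.+1 kn.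
  have kE : a + k.+1%:R * h - (a + k%:R * h) = h.
    by rewrite -addn1 natrD mulrDl mul1r; ring.
  have kk : a + k%:R * h <= a + k.+1%:R * h by rewrite -subr_ge0 kE.
  have := primitive_increment Tk0 Tk1 kk; have := Uinc _ _ Tk0 Tk1 kk.
  (* [U] gains at least [h] times [m] at the left end and the primitive at most [h] times [m] at the
     right end; the correction [h * m] changes by exactly the difference. *)
  rewrite kE => u /andP[_ v]; apply: le_trans (IH (ltnW kn)) _.
  lra.
have := step n (leqnn n); rewrite hn.
have /andP[m0 m1] := m01 Tth.
have : h * m th <= e by rewrite -[e]mulr1 ler_pM.
lra.
Qed.

End MonotonePrimitive.

(** * Case distinctions, quotients and null points *)

Section BoundedMeasurableMore.
Context {R : realType} (a b : R).
Local Notation Th := (Theta a b).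
Local Notation T := (gsT (BorelTheta a b)).
Implicit Types (f g : R -> R).

Lemma bm_id : bm a b id.
Proof.
split; first exact: measurable_id.
exists (`|a| + `|b|) => y; rewrite ThetaE => /andP[ay yb].
have := ler_norm b; have := ler_norm (- a); rewrite normrN ler_norml.
by have := normr_ge0 a; have := normr_ge0 b; lra.
Qed.

Lemma bm_if (c : R -> bool) f g : measurable_fun Th c ->
  bm a b f -> bm a b g -> bm a b (fun y => if c y then f y else g y).
Proof.
move=> mc [mf [M fM]] [mg [N gN]]; split.
  apply: measurable_fun_if => //; first exact: measurable_ThetaR.
  - by apply: measurable_funS mf; [exact: measurable_ThetaR|exact: subIsetl].
  - by apply: measurable_funS mg; [exact: measurable_ThetaR|exact: subIsetl].
exists (Num.max M N) => y Ty; rewrite le_max.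
by case: (c y); rewrite ?fM ?gN ?orbT.
Qed.

(* The quotient vanishes at the zeros of g, as [0^-1 = 0]. *)
Lemma bm_div f g M : bm a b f -> bm a b g -> (forall y, Th y -> 0 <= g y) ->
  (forall y, Th y -> `|f y| <= M * g y) -> bm a b (fun y => f y / g y).
Proof.
move=> [mf _] [mg _] g0 fMg; split.
  apply: measurable_funM => //.
  apply: (eq_measurable_fun (fun y => g y `^ (-1))).
    by move=> y; rewrite inE => Ty; rewrite powR_inv1// g0.
  exact: measurableT_comp (measurable_powR _) mg.
exists `|M| => y Ty; have := g0 _ Ty; rewrite le_eqVlt => /predU1P[<-|gy].
  by rewrite invr0 mulr0 normr0.
rewrite normrM normfV (gtr0_norm gy) ler_pdivrMr//.
by rewrite (le_trans (fMg _ Ty))// ler_wpM2r ?ler_norm// ltW.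
Qed.

Lemma bm_nondecreasing f M : (forall y, Th y -> `|f y| <= M) ->
  (forall y y', Th y -> Th y' -> y <= y' -> f y <= f y') -> bm a b f.
Proof.
by move=> fM fnd; split; [exact: nondecreasing_in_measurable|exists M].
Qed.

Variable P : probability T R.

Lemma normr_le_Ex f g : bm a b f -> bm a b g ->
  (forall y, Th y -> `|f y| <= g y) -> `|Ex P f| <= Ex P g.
Proof.
move=> bf bg fg; rewrite ler_norml; apply/andP; split; last first.
  by apply: le_Ex => // y /fg; rewrite ler_norml => /andP[].
rewrite -mulN1r -ExZ//; apply: le_Ex => //; first exact: bmZ.
by move=> y /fg; rewrite ler_norml mulN1r => /andP[].
Qed.

(** The subsets of a singleton are the empty set and itself, and neither has mass strictly between 0
    and that of the singleton. *)
Lemma atomless_set1 th : atomless P -> Th th -> P ([set th] : set T) = 0%E.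
Proof.
move=> Pat Tth; apply/eqP; rewrite eq_le measure_ge0 andbT leNgt.
apply/negP => Pth.
have m1 : measurable ([set th] : set T).
  by apply: measurable_BorelTheta => [_ ->//|]; exact: measurable_set1.
have [S [mS Sth /andP[]]] := Pat _ m1 Pth.
have [->|->] := subset_set1 Sth; first by rewrite measure0 ltxx.
by rewrite ltxx.
Qed.

(** Meant for the diagonal [y = th], where the allocation may take values other than 0 and 1. *)
Lemma le_Ex_off f g th : P ([set th] : set T) = 0%E -> Th th ->
  bm a b f -> bm a b g -> (forall y, Th y -> y != th -> f y <= g y) ->
  Ex P f <= Ex P g.
Proof.
move=> P0 Tth bf bg fg.
have m1 : measurable ([set th] : set T).
  by apply: measurable_BorelTheta => [_ ->//|]; exact: measurable_set1.
have mTh := @measurable_Theta R a b.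
have mD : measurable (Th `\ th).
  by apply: measurableD => //; exact: measurable_ThetaR.
rewrite /Ex (negligible_integral m1 mTh (bm_Theta_integrable P bf) P0).
rewrite (negligible_integral m1 mTh (bm_Theta_integrable P bg) P0).
have sD : Th `\ th `<=` Th by move=> y [].
apply: (@le_Rintegral _ T R P (Th `\ th) f g).
- exact: measurableD.
- exact: bm_integrable.
- exact: bm_integrable.
- by move=> y [Ty /eqP yth]; exact: fg.
Qed.

Lemma eq_Ex_off f g th : P ([set th] : set T) = 0%E -> Th th ->
  bm a b f -> bm a b g -> (forall y, Th y -> y != th -> f y = g y) ->
  Ex P f = Ex P g.
Proof.
move=> P0 Tth bf bg fg; apply/eqP; rewrite eq_le.
by rewrite !(@le_Ex_off _ _ th)// => y Ty yth; rewrite fg.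
Qed.

End BoundedMeasurableMore.

(** * A single bidder: incentives under win-lose dependent transfers *)

Section Bidder.
Context {R : realType} (a b : R).
Local Notation Th := (Theta a b).
Local Notation T := (gsT (BorelTheta a b)).
Variables (D : @divergence R) (P : probability T R) (eta : R).
Hypotheses (hD : assumptionD a b D) (hP : isProbTheta a b P) (heta : 0 < eta).
Hypothesis a0 : 0 < a.
Variable x : R -> R -> R.
Hypothesis bx : bounded_measurable a b x.
Hypothesis x01 : forall th y, Th th -> Th y -> 0 <= x th y <= 1.
Local Notation wc := (wc D P eta).
Local Notation m := (fun th => wc (x th)).
Local Notation V := (primitive a m).
Hypothesis mnd : forall s s', Th s -> Th s' -> s <= s' -> m s <= m s'.

Let bxs th : Th th -> bm a b (x th).
Proof. exact: bounded_measurable_section. Qed.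

Let mP := @plausible_ref R a b D P eta hD hP heta.

Lemma wc_win_le th : Th th -> m th <= Ex P (x th).
Proof. by move=> Tth; apply: (wc_ub hD hP heta) => //; exact: bxs. Qed.

Lemma wc_win01 th : Th th -> 0 <= m th <= 1.
Proof.
move=> Tth; apply/andP; split.
  apply: (wc_lb hD hP heta) => [|Q _]; first exact: bxs.
  by apply: Ex_ge0 => y Ty; have /andP[] := x01 Tth Ty.
rewrite (le_trans (wc_win_le Tth))// -(Ex_cst 1 hP); apply: le_Ex.
- exact: bxs.
- exact: bm_cst.
- by move=> y Ty; have /andP[] := x01 Tth Ty.
Qed.

(** The payoff is affine in [x thh]. At the true type [thh] its slope is nonnegative, so its worst
    case is exact and equals [V thh]; for type [th] it is at most [V thh + (th - thh) * m thh]. This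
    is a tangent to [V], which lies below [V] on either side of [thh]. *)
Lemma win_lose_deviation (t : R -> R) (tw tl : R) th thh :
  Th th -> Th thh ->
  (forall y, Th y -> t y = tw * x thh y + tl * (1 - x thh y)) ->
  - tl <= thh - tw ->
  wc (fun y => thh * x thh y - t y) = V thh ->
  wc (fun y => th * x thh y - t y) <= V th.
Proof.
move=> Tth Tthh tE wl.
have payoffE s : {in Th, (fun y => s * x thh y - t y) =1
    (fun y => (s - tw + tl) * x thh y + - tl)}.
  by move=> y; rewrite inE => Ty; rewrite tE//; ring.
rewrite (eq_wc D P eta (payoffE thh)) (eq_wc D P eta (payoffE th)).
rewrite wc_affine//; [|lra|exact: bxs].
have := wc_affine_le hD hP heta (th - tw + tl) (- tl) (bxs Tthh).
set mm := wc (x thh); move=> dev VE; apply: (le_trans dev).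
have -> : (th - tw + tl) * mm - tl = V thh + (th - thh) * mm by rewrite -VE; ring.
have [le|/ltW le] := leP thh th.
- have /andP[+ _] := primitive_increment wc_win01 mnd Tthh Tth le.
  by rewrite -/mm; lra.
- have /andP[_ +] := primitive_increment wc_win01 mnd Tth Tthh le.
  by rewrite -/mm; lra.
Qed.

(** * Improving the transfers of a feasible mechanism *)

Section Improvement.
Variable t : R -> R -> R.
Hypothesis bt : bounded_measurable a b t.
Local Notation U := (fun th => wc (fun y => th * x th y - t th y)).
Hypothesis ic : forall th thh, Th th -> Th thh ->
  wc (fun y => th * x thh y - t thh y) <= U th.
Hypothesis ir : forall th, Th th -> 0 <= U th.
Hypothesis P1 : forall th, Th th -> P ([set th] : set T) = 0%E.
Hypothesis xbin : forall th y, Th th -> Th y -> y != th -> x th y = 0 \/ x th y = 1.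
Hypothesis x1b : forall th, Th th -> Ex P (x th) = 1 -> th = b.

Let bts th : Th th -> bm a b (t th).
Proof. exact: bounded_measurable_section. Qed.

Let bpay s th : Th th -> bm a b (fun y => s * x th y - t th y).
Proof. by move=> Tth; apply: bmB; [apply: bmZ; exact: bxs|exact: bts]. Qed.

(** A type [s'] that reports a lower [s] adds [(s' - s) * x s] to the payoff of [s]. Superadditivity
    and incentive compatibility then give the increment that [le_primitive] asks for, and individual
    rationality at [a] gives the start. *)
Lemma le_primitive_payoff th : Th th -> V th <= U th.
Proof.
move=> Tth; apply: (le_primitive wc_win01 mnd _ _ Tth).
  apply: ir; move: Tth; rewrite !ThetaE lexx => /andP[]; exact: le_trans.
move=> s s' Ts Ts' ss'; apply: le_trans (ic Ts' Ts).
have := wcD hD hP heta (bpay s Ts) (bmZ (s' - s) (bxs Ts)).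
have E : {in Th, (fun y => (s' - s) * x s y) =1 (fun y => (s' - s) * x s y + 0)}.
  by move=> y _; rewrite addr0.
rewrite (eq_wc D P eta E) wc_affine//; [|lra|exact: bxs].
rewrite addr0 => /le_trans; apply.
rewrite le_eqVlt; apply/orP; left; apply/eqP; apply: eq_wc => y _; ring.
Qed.

(** [P] is itself plausible. This caps the expected payment at what full insurance at utility [V th]
    would yield. *)
Lemma payoff_le_mean th : Th th -> V th <= th * Ex P (x th) - Ex P (t th).
Proof.
move=> Tth; rewrite (le_trans (le_primitive_payoff Tth))//.
rewrite (le_trans (wc_ub hD hP heta (bpay th Tth) mP))// ExB ?ExZ//.
- exact: bxs.
- by apply: bmZ; exact: bxs.
- exact: bts.
Qed.

(** The conditional mean under [P] of the payment given winning, since [x th] is the indicator of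
    winning off the null diagonal. It is 0 when winning has probability 0, by the convention for
    division. *)
Definition mean_win th := Ex P (fun y => t th y * x th y) / Ex P (x th).
Definition mean_lose th :=
  Ex P (fun y => t th y * (1 - x th y)) / (1 - Ex P (x th)).
Definition gap th := th - mean_win th + mean_lose th.

Lemma mean_win_lose th : Th th -> 0 < Ex P (x th) < 1 ->
  Ex P (t th) = mean_win th * Ex P (x th) + mean_lose th * (1 - Ex P (x th)).
Proof.
move=> Tth /andP[X0 X1].
rewrite /mean_win /mean_lose !divfK ?subr_eq0 ?(gt_eqF X0) ?(gt_eqF X1)//.
have b1 : bm a b (fun y => t th y * x th y) := bmM (bts Tth) (bxs Tth).
have b2 : bm a b (fun y => t th y * (1 - x th y)).
  exact: bmM (bts Tth) (bmB (bm_cst a b 1) (bxs Tth)).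
by rewrite -ExD//; apply: eq_Ex => y _; ring.
Qed.

(** For each plausible [Q], the coarsened belief [Q'] for the winning set [W] values the old
    transfers at [gap th * Ex Q \1_W - mean_lose th]. As [gap th >= 0], this is at most the value of
    the averaged transfers under [Q]. *)
Lemma insured_payoff th : Th th -> 0 < Ex P (x th) < 1 -> 0 <= gap th ->
  V th <= gap th * m th - mean_lose th.
Proof.
move=> Tth X01 c0; apply: (le_trans (le_primitive_payoff Tth)).
have bX := bxs Tth; have bT := bts Tth.
have bC : bm a b (fun y => 1 - x th y) := bmB (bm_cst a b 1) bX.
pose W := [set y | Th y /\ x th y = 1].
have WTh : W `<=` Th by move=> y [].
have mW : measurable W.
  have := bX.1 (@measurable_ThetaR R a b) [set 1] (measurable_set1 1).
  by congr measurable; apply/seteqP; split.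
have bW : bm a b \1_W := bm_indic a b mW.
have W1 y : Th y -> y != th -> \1_W y = x th y.
  move=> Ty yth; rewrite indicE; case: (xbin Tth Ty yth) => xy; rewrite xy.
    rewrite memNset// => -[_]; rewrite xy => /esym/eqP.
    by rewrite oner_eq0.
  by rewrite mem_set.
have wE : Ex P \1_W = Ex P (x th) by exact: (eq_Ex_off (P1 Tth)).
have W01 : 0 < Ex P \1_W < 1 by rewrite wE.
rewrite -wc_affine//; apply: (wc_lb hD hP heta) => [|Q QQ].
  by apply: bmD; [exact: bmZ|exact: bm_cst].
have [Q' Q'Q Q'E] := plausible_coarsening hD hP WTh mW QQ W01.
rewrite (le_trans (wc_ub hD hP heta (bpay th Tth) Q'Q))//.
rewrite Q'E ?wE; last exact: bpay.
have /andP[X0 X1] := X01.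
(* Off the diagonal [\1_W] equals [x th], whose values 0 and 1 are idempotent, so the integral over
   the winning cell is the mean payoff there times its probability. *)
have -> : Ex P (fun y => (th * x th y - t th y) * \1_W y) =
    Ex P (x th) * (th - mean_win th).
  rewrite mulrBr [Ex P (x th) * mean_win th]mulrC divfK ?gt_eqF// mulrC.
  rewrite -ExZ// -ExB//; [|exact: bmZ|exact: bmM].
  apply: (eq_Ex_off (P1 Tth)) => //.
  - by apply: bmM => //; exact: bpay.
  - by apply: bmB; [exact: bmZ|exact: bmM].
  - move=> y Ty yth; rewrite W1//.
    by case: (xbin Tth Ty yth) => ->; ring.
have -> : Ex P (fun y => (th * x th y - t th y) * (1 - \1_W y)) =
    - ((1 - Ex P (x th)) * mean_lose th).
  rewrite [_ * mean_lose th]mulrC divfK ?subr_eq0 ?(gt_eqF X1)//.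
  rewrite -mulN1r -ExZ//; last exact: bmM.
  apply: (eq_Ex_off (P1 Tth)) => //.
  - by apply: bmM; [exact: bpay|exact: bmB (bm_cst a b 1) bW].
  - by apply: bmZ; exact: bmM.
  - move=> y Ty yth; rewrite W1//.
    by case: (xbin Tth Ty yth) => ->; ring.
have QT : isProbTheta a b Q by case: QQ.
rewrite Ex_affine//.
(* This holds pointwise, also at [y = th]: the allocation is 1 on [W] and nonnegative elsewhere. *)
have le1 : Ex Q \1_W <= Ex Q (x th).
  apply: le_Ex => // y Ty; rewrite indicE.
  have [/[!inE] -[_ ->]//|_] := boolP (y \in W).
  by have /andP[] := x01 Tth Ty.
have X1' : 1 - Ex P (x th) != 0 by rewrite subr_eq0 (gt_eqF X1).
rewrite mulrA divfK ?(gt_eqF X0)// mulrN mulrA divfK//.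
apply: le_trans (_ : gap th * Ex Q \1_W - mean_lose th <= _); last first.
  by rewrite lerD2r ler_wpM2l.
by rewrite le_eqVlt; apply/orP; left; apply/eqP; rewrite /gap; ring.
Qed.

(** The constraint is linear in the two payments, so it is averaged twice: over winning [y] with a
    losing [z] fixed, then over losing [z]. *)
Lemma mean_class alpha beta K th : Th th -> 0 <= alpha ->
  0 < Ex P (x th) < 1 ->
  (forall y z, Th y -> Th z -> x th y = 1 -> x th z = 0 ->
    alpha * t th y - beta * t th z <= K) ->
  alpha * mean_win th - beta * mean_lose th <= K.
Proof.
move=> Tth al0 /andP[X0 X1] cls.
have bX := bxs Tth; have bT := bts Tth.
have bC : bm a b (fun y => 1 - x th y) := bmB (bm_cst a b 1) bX.
have win z : Th z -> x th z = 0 -> alpha * mean_win th <= K + beta * t th z.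
  move=> Tz xz; rewrite mulrA ler_pdivrMr// -ExZ; last exact: bmM.
  rewrite -ExZ//; apply: (le_Ex_off (P1 Tth)) => //.
  - by apply: bmZ; exact: bmM.
  - exact: bmZ.
  - move=> y Ty yth; case: (xbin Tth Ty yth) => xy; rewrite xy ?mulr0// !mulr1.
    by have := cls y z Ty Tz xy xz; rewrite lerBlDr.
have X1' : 0 < 1 - Ex P (x th) by rewrite subr_gt0.
rewrite -(ler_pM2r X1') mulrBl -[beta * _ * _]mulrA divfK ?gt_eqF//.
have -> : 1 - Ex P (x th) = Ex P (fun y => 1 - x th y).
  by rewrite ExB ?Ex_cst//; exact: bm_cst.
rewrite lerBlDr -!ExZ//; last exact: bmM.
rewrite -ExD//; [|exact: bmZ|by apply: bmZ; exact: bmM].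
apply: (le_Ex_off (P1 Tth)) => //; first exact: bmZ.
  by apply: bmD; [exact: bmZ|apply: bmZ; exact: bmM].
move=> y Ty yth; case: (xbin Tth Ty yth) => xy; rewrite xy; last first.
  by rewrite subrr !mulr0 addr0.
by rewrite subr0 !mulr1; exact: win.
Qed.

Lemma bm_wc_win : bm a b m.
Proof.
apply: (@bm_nondecreasing _ _ _ _ 1) => // y Ty.
by have /andP[m0 m1] := wc_win01 Ty; rewrite ger0_norm.
Qed.

(** In particular [V] vanishes wherever [m] does, which settles the types that almost never win. *)
Lemma primitive_win_le th : Th th -> V th <= (th - a) * m th.
Proof.
move=> Tth; have := Tth; rewrite ThetaE => /andP[ath thb].
have Ta : Th a by rewrite ThetaE lexx (le_trans ath).
have /andP[_] := primitive_increment wc_win01 mnd Ta Tth ath.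
by rewrite primitive_left subr0.
Qed.

Lemma bm_primitive_win : bm a b V.
Proof.
apply: (@bm_nondecreasing _ _ _ _ (b - a)); last first.
  by move=> y y'; apply: primitive_nondecreasing => //; exact: wc_win01.
move=> y Ty; rewrite ger0_norm; last by apply: primitive_ge0 Ty; exact: wc_win01.
rewrite (le_trans (primitive_win_le Ty))//.
have /andP[m0 m1] := wc_win01 Ty.
move: Ty; rewrite ThetaE => /andP[ay yb].
by rewrite -[leRHS]mulr1 ler_pM// ?subr_ge0// lerD2r.
Qed.

(** The conditional means keep the bound [M] of the transfers however small their denominators: each
    numerator is at most [M] times its denominator in absolute value. *)
Lemma bm_gap : bm a b gap.
Proof.
have [_ [M tM]] := bt.
have bXX := bm_Ex hP bx.
have normx th y : Th th -> Th y -> `|x th y| = x th y /\ `|1 - x th y| = 1 - x th y.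
  by move=> Tth Ty; have /andP[u v] := x01 Tth Ty; rewrite !ger0_norm ?subr_ge0.
have b1x : bounded_measurable a b (fun th y => 1 - x th y).
  apply: bounded_measurableD; first exact: (bounded_measurable1 (bm_cst a b 1)).
  exact: bounded_measurableN.
have ExC th : Th th -> Ex P (fun y => 1 - x th y) = 1 - Ex P (x th).
  by move=> Tth; rewrite ExB ?Ex_cst//; [exact: bm_cst|exact: bxs].
apply: bmD; first apply: bmB; first exact: bm_id.
- apply: (@bm_div _ _ _ _ _ M) => //.
  + exact: bm_Ex hP (bounded_measurableM bt bx).
  + by move=> th Tth; apply: Ex_ge0 => y Ty; have /andP[] := x01 Tth Ty.
  + move=> th Tth; rewrite -ExZ; last exact: bxs.
    apply: normr_le_Ex.
    * by apply: bmM; [exact: bts|exact: bxs].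
    * by apply: bmZ; exact: bxs.
    * move=> y Ty; rewrite normrM (normx _ _ Tth Ty).1 ler_wpM2r ?tM//.
      by have /andP[] := x01 Tth Ty.
- apply: (@bm_div _ _ _ _ _ M) => //.
  + exact: bm_Ex hP (bounded_measurableM bt b1x).
  + exact: bmB (bm_cst a b 1) bXX.
  + move=> th Tth; rewrite -ExC//; apply: Ex_ge0 => y Ty.
    by have /andP[] := x01 Tth Ty; rewrite subr_ge0.
  + have b1 th : Th th -> bm a b (fun y => 1 - x th y).
      by move=> Tth; exact: bmB (bm_cst a b 1) (bxs Tth).
    move=> th Tth; rewrite -ExC// -ExZ; last exact: b1.
    apply: normr_le_Ex.
    * by apply: bmM; [exact: bts|exact: b1].
    * by apply: bmZ; exact: b1.
    * move=> y Ty; rewrite normrM (normx _ _ Tth Ty).2 ler_wpM2r ?tM//.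
      by have /andP[] := x01 Tth Ty; rewrite subr_ge0.
Qed.

(* The amount by which winning is better than losing under the improved
   transfers: the conditional means keep their gap unless winning was worse,
   in which case the bidder is fully insured. When winning has probability 0,
   the value [th] makes both payments vanish. *)
Definition spread th : R :=
  if th == b then 0 else if Ex P (x th) == 0 then th else Num.max 0 (gap th).

(** [pay_win] and [pay_lose] solve two equations: winning is better than losing by [spread th], and
    the worst-case utility [spread th * m th - pay_lose th] equals [V th]. *)
Definition pay_win th : R := th - V th - spread th * (1 - m th).
Definition pay_lose th : R := spread th * m th - V th.

Lemma spread_ge0 th : Th th -> 0 <= spread th.
Proof.
rewrite ThetaE /spread => /andP[ath _]; case: ifP => // _; case: ifP => _.
  exact: le_trans (ltW a0) ath.
by rewrite le_max lexx.
Qed.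

Lemma bm_spread : bm a b spread.
Proof.
have bid := bm_id a b; have bXX := bm_Ex hP bx.
have b0 := bm_cst a b 0.
apply: bm_if => //; first exact: measurable_fun_eqr.
apply: bm_if => //; first by apply: measurable_fun_eqr => //; exact: bXX.1.
exact: bm_max b0 bm_gap.
Qed.

Lemma bm_pay_win : bm a b pay_win.
Proof.
apply: bmB; first exact: bmB (bm_id a b) bm_primitive_win.
exact: bmM bm_spread (bmB (bm_cst a b 1) bm_wc_win).
Qed.

Lemma bm_pay_lose : bm a b pay_lose.
Proof. exact: bmB (bmM bm_spread bm_wc_win) bm_primitive_win. Qed.

Lemma spreadE th : th - pay_win th + pay_lose th = spread th.
Proof. by rewrite /pay_win /pay_lose; ring. Qed.

Lemma wc_improved (t' : R -> R) th : Th th ->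
  (forall y, Th y -> t' y = pay_win th * x th y + pay_lose th * (1 - x th y)) ->
  wc (fun y => th * x th y - t' y) = V th.
Proof.
move=> Tth t'E.
have E : {in Th, (fun y => th * x th y - t' y) =1
    (fun y => spread th * x th y + - pay_lose th)}.
  by move=> y; rewrite inE => Ty; rewrite t'E// -spreadE; ring.
rewrite (eq_wc D P eta E) wc_affine//; [|exact: spread_ge0|exact: bxs].
by rewrite /pay_lose; ring.
Qed.

Lemma win_prob01 th : Th th -> 0 <= Ex P (x th) <= 1.
Proof.
move=> Tth; apply/andP; split.
  by apply: Ex_ge0 => y Ty; have /andP[] := x01 Tth Ty.
rewrite -(Ex_cst 1 hP); apply: le_Ex; [exact: bxs|exact: bm_cst|].
by move=> y Ty; have /andP[] := x01 Tth Ty.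
Qed.

Lemma win_prob_lt1 th : Th th -> th != b -> Ex P (x th) < 1.
Proof.
move=> Tth thb; have /andP[_] := win_prob01 Tth.
by rewrite le_eqVlt => /predU1P[/(x1b Tth)/eqP|//]; rewrite (negbTE thb).
Qed.

(** The new mean payment is [th * Ex P (x th) - V th - spread th * (Ex P (x th) - m th)]. Where the
    last term vanishes, [payoff_le_mean] suffices; where the spread is the gap, [insured_payoff] is
    the same inequality rearranged. *)
Lemma mean_improved th : Th th -> Ex P (t th) <=
  Ex P (fun y => pay_win th * x th y + pay_lose th * (1 - x th y)).
Proof.
move=> Tth; have bX := bxs Tth.
have -> : Ex P (fun y => pay_win th * x th y + pay_lose th * (1 - x th y)) =
    th * Ex P (x th) - V th - spread th * (Ex P (x th) - m th).
  rewrite (@eq_Ex _ _ _ _ _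
    (fun y => (pay_win th - pay_lose th) * x th y + pay_lose th)); last first.
    by move=> y _; ring.
  by rewrite Ex_affine// /pay_win /pay_lose; ring.
have mean := payoff_le_mean Tth; rewrite /spread.
(* At [b] winning may be certain, so the mean given losing may be meaningless; the zero spread there
   means full insurance. *)
have [_|thb] := eqVneq th b; first by rewrite mul0r; lra.
have /andP[X0 _] := win_prob01 Tth; have X1 := win_prob_lt1 Tth thb.
have [XE|Xn0] := eqVneq (Ex P (x th)) 0.
  have /andP[m0 _] := wc_win01 Tth; have := wc_win_le Tth.
  rewrite XE => m0'; have -> : m th = 0 by apply/eqP; rewrite eq_le m0 m0'.
  by move: mean; rewrite XE; lra.
have X01 : 0 < Ex P (x th) < 1 by rewrite lt_neqAle eq_sym Xn0 X0.
have [g0|g0] := ltP (gap th) 0.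
  by rewrite mul0r; lra.
have := insured_payoff Tth X01 g0; rewrite (mean_win_lose Tth X01) /gap.
by lra.
Qed.

(** Since [alpha <= beta], adding a nonnegative constant to both payments preserves the bound. If
    [gap th >= 0], the new payments are the conditional means plus such a constant. If [gap th < 0],
    the winning mean is first lowered to [th + mean_lose th], which is harmless as [alpha >= 0]. *)
Lemma class_improved alpha beta K th : Th th -> th < b ->
  0 <= alpha -> alpha <= beta -> 0 <= K ->
  (forall y z, Th y -> Th z -> x th y = 1 -> x th z = 0 ->
    alpha * t th y - beta * t th z <= K) ->
  alpha * pay_win th - beta * pay_lose th <= K.
Proof.
move=> Tth thb al0 albe K0 cls; have thb' : th != b by rewrite lt_eqF.
have mean := payoff_le_mean Tth.
have /andP[X0 _] := win_prob01 Tth; have X1 := win_prob_lt1 Tth thb'.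
rewrite /pay_win /pay_lose /spread (negbTE thb').
have [XE|Xn0] := eqVneq (Ex P (x th)) 0.
  have /andP[m0 _] := wc_win01 Tth; have := wc_win_le Tth.
  rewrite XE => m0'; have mE : m th = 0 by apply/eqP; rewrite eq_le m0 m0'.
  have := primitive_win_le Tth; have := primitive_ge0 wc_win01 Tth.
  rewrite mE mulr0 => V0 V0'.
  have -> : V th = 0 by apply/eqP; rewrite eq_le V0 V0'.
  by apply: le_trans K0; rewrite le_eqVlt; apply/orP; left; apply/eqP; ring.
have X01 : 0 < Ex P (x th) < 1 by rewrite lt_neqAle eq_sym Xn0 X0.
have := mean_class Tth al0 X01 cls.
have be0 : 0 <= beta - alpha by rewrite subr_ge0.
have [g0|g0] := ltP (gap th) 0.
- move: mean; rewrite (mean_win_lose Tth X01) => mean.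
  (* The constant added to both payments under full insurance; its sign comes from [payoff_le_mean]
     and the negative gap. *)
  have V1 : 0 <= - mean_lose th - V th.
    have : gap th * Ex P (x th) <= 0 by rewrite nmulr_rle0.
    by move: mean; rewrite /gap; lra.
  have := mulr_ge0 be0 V1.
  have : 0 <= alpha * (- gap th) by rewrite mulr_ge0// oppr_ge0 ltW.
  by rewrite /gap; lra.
- have := insured_payoff Tth X01 g0; rewrite -subr_ge0 => V1.
  have := mulr_ge0 be0 V1.
  by rewrite /gap; lra.
Qed.

End Improvement.
End Bidder.

(** * From the single bidder to the auction *)

Theorem theorem1 (R : realType) (a b : R) (hab : 0 < a < b)
  (D : divergence) (hD : @assumptionD R a b D)
  (P : probability (gsT (BorelTheta a b)) R) (hP : isProbTheta a b P)
  (hPat : @atomless R a b P) (eta : R) (heta : 0 < eta)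
  (x : 'I_2 -> R -> R -> R) (hx : @allocation_rule R a b x)
  (hX : @assumptionX R a b D P eta x)
  (alpha beta K : R) (halpha : 0 <= alpha) (hab' : alpha <= beta) (hbeta : beta <= 1)
  (hK : 0 <= K)
  (t : 'I_2 -> R -> R -> R) :
  @solvesR R a b D P eta alpha beta K x t -> @solvesP R a b D P eta alpha beta K x t.
Proof.
move=> [[bt wld UV cls] tmax]; have [a0 ab] := andP hab.
have [bx xsum] := hx; have [xbin x1b Xnd] := hX.
have x01 i th y : Theta a b th -> Theta a b y -> 0 <= x i th y <= 1.
  have i12 : i = bidder1 \/ i = bidder2.
    by case: i => -[|[|//]] ?; [left|right]; exact: val_inj.
  move=> Tth Ty; case: i12 => ->.
  - by have [x1 x2 x12] := xsum _ _ Tth Ty; rewrite x1/=; lra.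
  - by have [x1 x2 x12] := xsum _ _ Ty Tth; rewrite x2/=; lra.
have bxs i th : Theta a b th -> bm a b (x i th).
  by move=> Tth; exact: bounded_measurable_section (bx i) Tth.
pose m i th := wc D P eta (x i th).
have XminE i th : Theta a b th -> Xmin D P eta x i th = (m i th)%:E.
  by move=> Tth; rewrite /Xmin (worst_caseE hD hP heta)//; exact: bxs.
have mnd i s s' : Theta a b s -> Theta a b s' -> s <= s' -> m i s <= m i s'.
  by move=> Ts Ts' ss'; rewrite -lee_fin -!XminE//; exact: Xnd.
have m01 i s : Theta a b s -> 0 <= m i s <= 1.
  by move=> Ts; exact: (wc_win01 hD hP heta (bx i) (x01 i) Ts).
have VE i th : Theta a b th ->
    (\int[lebesgue_measure]_(z in `[a, th]) Xmin D P eta x i z)%E =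
    (primitive a (m i) th)%:E.
  move=> Tth; rewrite -(integral_primitive (m01 i) (mnd i) Tth).
  apply: eq_integral => z; rewrite inE /= in_itv/= => /andP[az zth].
  apply: XminE; move: Tth; rewrite !ThetaE az => /andP[_].
  exact: le_trans.
have UrepE (t' : 'I_2 -> R -> R -> R) i th thh : transfer_rule a b t' ->
    Theta a b thh -> Urep D P eta x t' i th thh =
    (wc D P eta (fun y => th * x i thh y - t' i thh y))%:E.
  move=> bt' Tthh; rewrite /Urep (worst_caseE hD hP heta)//.
  apply: bmB; first by apply: bmZ; exact: bxs.
  exact: bounded_measurable_section (bt' i) Tthh.
have TexpE (t' : 'I_2 -> R -> R -> R) i th : transfer_rule a b t' ->
    Theta a b th -> Texp P t' i th = (Ex P (t' i th))%:E.
  move=> bt' Tth; rewrite /Texp integralEx//.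
  exact: bounded_measurable_section (bt' i) Tth.
have rev_le (t1 t2 : 'I_2 -> R -> R -> R) :
    transfer_rule a b t1 -> transfer_rule a b t2 ->
    (forall i th, Theta a b th -> Ex P (t1 i th) <= Ex P (t2 i th)) ->
    (revenue P t1 <= revenue P t2)%E.
  move=> bt1 bt2 t12; rewrite /revenue; apply: lee_sum => i _.
  have intE (t' : 'I_2 -> R -> R -> R) : transfer_rule a b t' ->
      (\int[P]_(th in (Theta a b : set (gsT (BorelTheta a b)))) Texp P t' i th =
       (Ex P (fun th => Ex P (t' i th)))%:E)%E.
    move=> bt'; rewrite -integralEx; last exact: bm_Ex hP (bt' i).
    by apply: eq_integral => th /set_mem Tth; exact: TexpE.
  rewrite !intE// lee_fin; apply: le_Ex; last exact: t12.
  - exact: bm_Ex hP (bt1 i).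
  - exact: bm_Ex hP (bt2 i).
have UminR i th : Theta a b th ->
    wc D P eta (fun y => th * x i th y - t i th y) = primitive a (m i) th.
  by move=> Tth; apply: EFin_inj; rewrite -VE// -UV// /Umin UrepE.
(* The solution of (R) is first shown admissible for (P); every rival in (P) is then dominated by a
   rule admissible for (R). *)
split.
  split=> //; split.
  - move=> i th thh Tth Tthh; rewrite !UrepE// lee_fin UminR//.
    have [tw [tl twl]] := wld; have [tE le_wl] := twl i thh Tthh.
    exact: (win_lose_deviation hD hP heta (bx i) (x01 i) (mnd i) Tth Tthh tE
      le_wl (UminR i thh Tthh)).
  - move=> i th Tth; rewrite /Umin UrepE// lee_fin UminR//.
    exact: (primitive_ge0 (m01 i) Tth).
move=> t' [bt' [ic ir] cls'].
have ic' i th thh : Theta a b th -> Theta a b thh ->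
    wc D P eta (fun y => th * x i thh y - t' i thh y) <=
    wc D P eta (fun y => th * x i th y - t' i th y).
  by move=> Tth Tthh; rewrite -lee_fin -!UrepE//; exact: ic.
have ir' i th : Theta a b th ->
    0 <= wc D P eta (fun y => th * x i th y - t' i th y).
  by move=> Tth; rewrite -lee_fin -UrepE//; exact: ir.
have P1 th : Theta a b th -> P [set th] = 0%E by exact: atomless_set1.
have x1b' i th : Theta a b th -> Ex P (x i th) = 1 -> th = b.
  move=> Tth Xth; apply: (x1b i) => //.
  by rewrite /Xexp integralEx ?Xth//; exact: bxs.
pose tw i := pay_win D P eta (x i) (t' i).
pose tl i := pay_lose D P eta (x i) (t' i).
pose t2 i th y := tw i th * x i th y + tl i th * (1 - x i th y).
have bt2 : transfer_rule a b t2.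
  move=> i; have bxi := bx i.
  have btw : bm a b (tw i).
    exact: (bm_pay_win hD hP heta bxi (x01 i) (mnd i) (bt' i)).
  have btl : bm a b (tl i).
    exact: (bm_pay_lose hD hP heta bxi (x01 i) (mnd i) (bt' i)).
  apply: bounded_measurableD.
    exact: bounded_measurableM (bounded_measurable1 btw) bxi.
  apply: bounded_measurableM; first exact: bounded_measurable1 btl.
  apply: bounded_measurableD; first exact: (bounded_measurable1 (bm_cst a b 1)).
  exact: bounded_measurableN.
have rev2 : (revenue P t' <= revenue P t2)%E.
  apply: rev_le => // i th Tth.
  exact: (mean_improved hD hP heta (bx i) (x01 i) (mnd i) (bt' i) (ic' i)
    (ir' i) P1 (xbin i) (x1b' i) Tth).
apply: (le_trans rev2); apply: tmax; split => //.
(* The requirement that winning be no worse than losing is the nonnegativity of the spread. *)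
- exists tw, tl => i th Tth; split=> //.
  have := spread_ge0 P a0 (x i) (t' i) Tth.
  rewrite -(spreadE D P eta) -/(tw i th) -/(tl i th).
  by lra.
- move=> i th Tth; rewrite VE// /Umin UrepE//; congr EFin.
  exact: (wc_improved hD hP heta a0 (bx i) Tth).
- move=> i th thw thl Tth thb Tw Tl xw xl.
  rewrite /t2 xw xl mulr1 subrr mulr0 addr0 mulr0 add0r subr0 mulr1.
  apply: (class_improved hD hP heta (bx i) (x01 i) (mnd i) (bt' i) (ic' i)
    (ir' i) P1 (xbin i) (x1b' i) Tth thb halpha hab' hK) => y z Ty Tz xy xz.
  exact: (cls' i th y z).
Qed.
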